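(* No single-threshold constant-approximation is possible on the $\overline{\mathcal{G}}$ class: there is no constant $c>0$ such that for every horizon $H\in\overline{\mathcal{G}}$ and every value distribution $\mathcal{D}$ there exists a threshold $\pi$ with $\mathbb{E}X_{\tau_\pi}\ge c\,\mathbb{E}M_H$.
   Context: IID prophet inequality with random horizon: $X$ is a nonnegative integrable random variable with distribution $\mathcal{D}$, $X_1,X_2,\dots$ i.i.d. copies. A horizon is a random variable $H$ supported on a subset of $\mathbb{N}=\{1,2,\dots\}$ with $\mathbb{E}H<\infty$, independent of the $X_i$. A stopping rule $\tau$ is adapted to $\mathcal{F}_i=\sigma(\mathbb{1}_{\{H=0\}},X_1,\dots,\mathbb{1}_{\{H=i-1\}},X_i)$ (the gambler must decide at step $i$ before learning whether $H=i$), the reward is $Y_\tau$ with $Y_i=X_i\mathbb{1}_{\{H\ge i\}}$, $Y_\infty=0$, and $\mathbb{E}X_\tau:=\mathbb{E}Y_\tau$. The prophet gets $\mathbb{E}M_H$, $M_H=\max_{i\le H}X_i$. A single-threshold algorithm with threshold $\pi$ (chosen knowing $\mathcal{D}$ and the law of $H$) is $\tau_\pi=\inf\{i: Y_i\ge\pi\}$. The $\overline{\mathcal{G}}$ class: $H\in\overline{\mathcal{G}}$ iff $\mathbb{E}[t^G]\le\mathbb{E}[t^H]$ for all $t\in(0,1)$, where $G$ is geometric on $\mathbb{N}$ with mean $\mu=\mathbb{E}H$, $\mathbb{P}(G=h)=\frac1\mu(1-\frac1\mu)^{h-1}$. *)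

(* Defs.v *)
From HB Require Import structures.
From mathcomp Require Import all_boot all_order all_algebra.
From mathcomp Require Import all_classical all_reals all_analysis.
Set Implicit Arguments. Unset Strict Implicit. Unset Printing Implicit Defensive.
Import Order.TTheory GRing.Theory Num.Theory.
Import numFieldNormedType.Exports.
Local Open Scope classical_set_scope.
Local Open Scope ring_scope.
Local Open Scope ereal_scope.

Section Defs.
Variable R : realType.

Definition nonneg_integrable (D : probability R R) : Prop :=
  D [set x : R | x < 0]%R = 0 /\ D.-integrable setT (fun x : R => x%:E).

Definition horizon (q : nat -> R) : Prop :=
  [/\ (forall h, 0 <= q h)%R, q 0%N = 0%R,
      \sum_(h <oo) (q h)%:E = 1
    & \sum_(h <oo) ((h%:R * q h)%R)%:E < +oo].

Definition meanH (q : nat -> R) : R := fine (\sum_(h <oo) ((h%:R * q h)%R)%:E).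

Definition tailH (q : nat -> R) (i : nat) : \bar R := \sum_(i <= h <oo) (q h)%:E.

Definition pgf_geom (mu t : R) : \bar R :=
  \sum_(1 <= h <oo) ((mu^-1 * (1 - mu^-1) ^+ h.-1 * t ^+ h)%R)%:E.

Definition pgfH (q : nat -> R) (t : R) : \bar R :=
  \sum_(h <oo) ((q h * t ^+ h)%R)%:E.

Definition Gbar (q : nat -> R) : Prop :=
  horizon q /\
  forall t : R, (0 < t < 1)%R -> pgf_geom (meanH q) t <= pgfH q t.

(** EmaxN D h m = E[max(m, X_1, ..., X_h)] for X_1,...,X_h i.i.d. ~ D,
    written as the iterated integral over the product law D^h. *)
Fixpoint EmaxN (D : probability R R) (h : nat) (m : R) : \bar R :=
  match h with
  | 0%N => m%:E
  | h'.+1 => \int[D]_x EmaxN D h' (Num.max m x)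
  end.

(** E[M_h] = E[max_{i<=h} X_i] (X >= 0 a.s., so M_h = max(0,X_1..X_h) a.s.;
    M_0 = max of the empty family is taken to be 0, irrelevant since
    P(H=0)=0). *)
Definition EM (D : probability R R) (h : nat) : \bar R := EmaxN D h 0%R.

(** Prophet value E[M_H] = sum_h P(H=h) E[M_h] (H independent of the X_i). *)
Definition prophet (D : probability R R) (q : nat -> R) : \bar R :=
  \sum_(h <oo) (q h)%:E * EM D h.

(** Expected reward E[X_{tau_pi}] = E[Y_{tau_pi}] of the single-threshold rule
    tau_pi = inf {i : Y_i >= pi}, Y_i = X_i 1{H >= i}, Y_oo = 0:
      sum_{i>=1} P(H >= i) P(X < pi)^(i-1) E[X 1{X >= pi}]
    ({tau_pi = i} = {H >= i, X_1 < pi, ..., X_(i-1) < pi, X_i >= pi}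
     when pi > 0; when pi <= 0, tau_pi = 1 and the formula gives E X). *)
Definition threshold_value (D : probability R R) (q : nat -> R) (pi : R)
  : \bar R :=
  \sum_(1 <= i <oo)
     (tailH q i * ((fine (D [set x : R | x < pi]%R)) ^+ i.-1)%:E *
      \int[D]_(x in [set x : R | pi <= x]%R) x%:E).

End Defs.

(* Main.v *)
(** Superpose geometric scales [k = 0, ..., m]: let [H = 4^k] with probability
    about [2^-k] and [X = 2^j] with probability about [4^-j]. When [H = 4^k]
    the maximum is of order [2^k], so each scale contributes a constant to the
    prophet, who gets at least [m / 8]. A threshold in [(2^(j-1), 2^j]] only
    exploits the scale [j]: conditionally on stopping it earns [O(2^j)], and
    it stops with probability [O(2^-j)], so it gets at most [6].

    For membership in G-bar write [N = H - 1], [s = 1 - t] and [z = s E N]; the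
    claim is [E (1 - s)^N >= 1 / (1 + z)]. As [P(N > 0) <= 1/4], it follows by
    concavity from [1 - (1 - s)^N <= N s / (1 + N s / 4)], valid for
    [N <> 1]. *)

Require Import Defs.
From HB Require Import structures.
From mathcomp Require Import all_boot all_order all_algebra.
From mathcomp Require Import all_classical all_reals all_analysis.
From mathcomp Require Import measurable_realfun ring lra.
Import Order.TTheory GRing.Theory Num.Theory.
Local Open Scope classical_set_scope.
Local Open Scope ring_scope.

(** * Truncated geometric sums and elementary bounds on powers *)

Section RealEstimates.
Context {R : realType}.
Implicit Types (r s t x y z : R) (N n m j k : nat).

Lemma sum_expr_le r n : 0 <= r < 1 -> \sum_(i < n) r ^+ i <= (1 - r)^-1.
Proof.
move=> /andP[r0 r1]; rewrite -[leRHS]mul1r ler_pdivlMr ?subr_gt0//.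
have -> : (\sum_(i < n) r ^+ i) * (1 - r) = 1 - r ^+ n.
  by rewrite -[RHS]opprB subrX1; ring.
by rewrite gerBl exprn_ge0.
Qed.

Lemma sum_exprS_le r n : 0 <= r < 1 -> (1 - r) * \sum_(i < n) r ^+ i.+1 <= r.
Proof.
move=> r01; rewrite mulrC -ler_pdivlMr; last by rewrite subr_gt0; case/andP: r01.
under eq_bigr do rewrite exprS.
by rewrite -mulr_sumr ler_wpM2l ?sum_expr_le//; case/andP: r01.
Qed.

(** The indicator truncates the sum at [minn n j], which is the form the induction carries. This
    bound and the next one serve to split the scales at [j], below and above the threshold. *)
Lemma sum_ltn_exp2_le n j :
  \sum_(i < n) (i < j)%:R * 2 ^+ i <= 2 ^+ j :> R.
Proof.
suff : \sum_(i < n) (i < j)%:R * 2 ^+ i <= 2 ^+ minn n j :> R.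
  by move=> /le_trans; apply; rewrite ler_eXn2l ?geq_minr// ltr1n.
elim: n => [|n IHn]; first by rewrite big_ord0 min0n expr0.
rewrite big_ord_recr/=; have [nj|jn] := ltnP n j.
  rewrite (minn_idPl nj) exprS mul1r; move: IHn; rewrite (minn_idPl (ltnW nj)).
  by lra.
by rewrite mul0r addr0 (le_trans IHn)// ler_eXn2l ?ltr1n// leq_min geq_minr
  geq_min leqnSn.
Qed.

Lemma sum_geq_half_le n j :
  \sum_(i < n) (j <= i)%:R * 2^-1 ^+ i <= 2 * 2^-1 ^+ j :> R.
Proof.
have e0 k : 0 <= 2^-1 ^+ k :> R by rewrite exprn_ge0// invr_ge0.
suff : \sum_(i < n) (j <= i)%:R * 2^-1 ^+ i
    <= if (j <= n)%N then 2 * 2^-1 ^+ j - 2 * 2^-1 ^+ n else 0 :> R.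
  move=> /le_trans; apply; have := e0 n; have := e0 j.
  by case: ifP => _; lra.
elim: n => [|n IHn].
  by rewrite big_ord0; case: ifP => //; rewrite leqn0 => /eqP ->; rewrite subrr.
rewrite big_ord_recr/=; have [jn|nj] := leqP j n.
  by move: IHn; rewrite jn (leqW jn) mul1r exprS; set y := _ ^+ n; lra.
rewrite mul0r addr0; move: IHn; rewrite leqNgt nj/= => /le_trans; apply.
case: leqP => // jn; have -> : j = n.+1 by apply/eqP; rewrite eqn_leq jn nj.
by rewrite subrr.
Qed.

Lemma sum_ltn_expr_le r n K : 0 <= r <= 1 ->
  \sum_(i < n) (i < K)%:R * r ^+ i <= K%:R.
Proof.
move=> /andP[r0 r1].
suff : \sum_(i < n) (i < K)%:R * r ^+ i <= (minn n K)%:R.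
  by move=> /le_trans; apply; rewrite ler_nat geq_minr.
elim: n => [|n IHn]; first by rewrite big_ord0 min0n.
rewrite big_ord_recr/=; have [nK|Kn] := ltnP n K.
  move: IHn; rewrite (minn_idPl nK) (minn_idPl (ltnW nK)) -natr1 mul1r => IHn.
  by rewrite lerD// exprn_ile1.
by rewrite mul0r addr0 (le_trans IHn)// ler_nat leq_min geq_minr geq_min leqnSn.
Qed.

(** With y = 1/n, Bernoulli gives (1 + y)^n >= 2, while (1 - y)^n (1 + y)^n = (1 - y^2)^n <= 1. *)
Lemma expr_1subV_le n : (0 < n)%N -> (1 - n%:R^-1) ^+ n <= 2^-1 :> R.
Proof.
move=> n0; have n0R : 0 < n%:R :> R by rewrite ltr0n.
set y := (n%:R^-1 : R).
have y01 : 0 <= y <= 1 by rewrite invr_ge0 ler0n invf_le1// ler1n.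
have bern k : 1 + k%:R * y <= (1 + y) ^+ k.
  elim: k => [|k IHk]; first by rewrite mul0r addr0 expr0.
  have : 0 <= k%:R * y by rewrite mulr_ge0// ; case/andP: y01.
  rewrite exprS -natr1; set u := k%:R * y; move: IHk; rewrite -/u.
  by rewrite mulrDl mul1r -/u => IHk u0; case/andP: y01 => *; nra.
have : 2 <= (1 + y) ^+ n.
  by apply: le_trans (bern n); rewrite /y divff ?gt_eqF//; lra.
have : (1 - y) ^+ n * (1 + y) ^+ n <= 1.
  by rewrite -exprMn exprn_ile1//; case/andP: y01 => *; nra.
have : 0 <= (1 - y) ^+ n by rewrite exprn_ge0// subr_ge0; case/andP: y01.
set a := (1 - y) ^+ n; set b := (1 + y) ^+ n => *.
by rewrite -[leRHS]mul1r ler_pdivlMr//; nra.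
Qed.

(** Induction from N = 2, where clearing the denominator leaves 2s - s^3/2 <= 2s. *)
Lemma one_sub_expr_le s N : 0 <= s <= 1 -> (1 < N)%N ->
  1 - (1 - s) ^+ N <= N%:R * s / (1 + N%:R * s / 4).
Proof.
move=> /andP[s0 s1]; case: N => // -[//|N] _.
elim: N => [|N IHN].
  by rewrite ler_pdivlMr ?expr2; nra.
have su : s <= N.+2%:R * s by rewrite ler_peMl// ler1n.
have -> : N.+3%:R * s = N.+2%:R * s + s by rewrite -addn1 natrD mulrDl mul1r.
rewrite (exprS _ N.+2); move: su IHN.
move: (N.+2%:R * s) ((1 - s) ^+ N.+2) => u x su IHN.
have P0 : 0 < 1 + u / 4 by lra.
have Q0 : 0 < 1 + (u + s) / 4 by lra.
move: IHN; rewrite ler_pdivlMr// => IHN; rewrite ler_pdivlMr//.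
rewrite -(ler_pM2r P0).
(* [h1] is the induction hypothesis scaled by a nonnegative factor. Once it is substituted, the
   slack left in the goal is exactly the quantity in [h2], nonnegative because s <= u. *)
have h1 : (1 - s) * (1 + (u + s) / 4) * (1 + u / 4 - u)
    <= (1 - s) * (1 + (u + s) / 4) * (x * (1 + u / 4)).
  by rewrite ler_wpM2l//; [rewrite mulr_ge0//; lra|lra].
have h2 : s * ((u - s) / 4 + u / 4 + 3 / 16 * (u * (u + s))) >= 0.
  by rewrite mulr_ge0// !addr_ge0// ?mulr_ge0//; lra.
by nra.
Qed.

(* The tangent-line bound of the concave function [u => u / (1 + u / 4)] at
   [u = 4 z]; averaging it replaces an appeal to Jensen's inequality. *)
Lemma expr_1sub_ge s z N : 0 <= s <= 1 -> 0 <= z -> (1 < N)%N ->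
  1 - (N%:R * s + 4 * z ^+ 2) / (1 + z) ^+ 2 <= (1 - s) ^+ N.
Proof.
move=> s01 z0 N1; have := one_sub_expr_le _ _ s01 N1.
have : 0 <= N%:R * s by rewrite mulr_ge0//; case/andP: s01.
set u := N%:R * s => u0 h.
suff : u / (1 + u / 4) <= (u + 4 * z ^+ 2) / (1 + z) ^+ 2 by lra.
rewrite ler_pdivrMr; last by lra.
rewrite mulrAC ler_pdivlMr; last by rewrite exprn_gt0//; lra.
(* With denominators cleared, the two sides differ by exactly this square. *)
have : 0 <= (u / 2 - 2 * z) ^+ 2 by rewrite sqr_ge0.
by rewrite !expr2; lra.
Qed.

End RealEstimates.

(** * Lower bound for the expected maximum of independent draws *)

Section MaxLowerBound.
Context {R : realType}.

Import HBNNSimple.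

(* [f] need not be measurable: the integral of a nonnegative function is a
   supremum over the simple functions below it. This spares a proof that
   [EmaxN D h] is measurable. *)
Lemma integral_ge_indic d (T : measurableType d) (mu : {measure set T -> \bar R})
    (A : set T) (f : T -> \bar R) (b c : R) :
  measurable A -> 0 <= b -> 0 <= c ->
  (forall x, ((b + c * \1_A x)%:E <= f x)%E) ->
  (b%:E * mu setT + c%:E * mu A <= \int[mu]_x f x)%E.
Proof.
move=> mA b0 c0 bcf.
have f0 x : (0 <= f x)%E.
  by apply: le_trans (bcf x); rewrite lee_fin addr_ge0// mulr_ge0// indicE.
pose g := add_nnsfun (cst_nnsfun T (NngNum b0))
            (scale_nnsfun (indic_nnsfun R mA) c0).
have gE x : g x = b + c * \1_A x by [].
have : (sintegral mu g <= \int[mu]_x f x)%E.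
  by rewrite ge0_integralTE//; apply: ereal_sup_ubound; exists g.
apply: le_trans; rewrite -integralT_nnsfun.
under eq_integral do rewrite gE EFinD EFinM.
rewrite ge0_integralD//=; last 2 first.
- by move=> x _; rewrite -EFinM lee_fin mulr_ge0// indicE.
- by apply/measurable_EFinP; apply: measurable_funM => //; exact: measurable_indic.
rewrite integral_cst// ge0_integralZl//=; last first.
  exact/measurable_EFinP/measurable_indic.
by rewrite integral_indic// setIT.
Qed.

(** The maximum is at least v times the indicator that it reaches v, and h draws all stay below v
    with probability (1 - p)^h. The case split on the running maximum [m] makes the induction go
    through. *)
Lemma EmaxN_ge (D : probability R R) (v : R) (h : nat) (m : R) :
  0 <= v -> 0 <= m ->
  ((if v <= m then v
    else v * (1 - (1 - fine (D [set x | v <= x]%R)) ^+ h))%:E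
   <= EmaxN D h m)%E.
Proof.
move=> v0; set A := [set x | v <= x]%R; set p := fine (D A).
have mA : measurable A by rewrite /A -set_itvcy; exact: measurable_itv.
have DAp : D A = p%:E by rewrite /p fineK// fin_num_measure.
have p01 : 0 <= p <= 1 by rewrite -!lee_fin -DAp measure_ge0 probability_le1.
have e01 k : 0 <= (1 - p) ^+ k <= 1.
  by rewrite exprn_ge0 ?exprn_ile1//; lra.
elim: h m => [|h IHh] m m0.
  by rewrite lee_fin expr0 subrr mulr0; case: ifP.
have M0 x : 0 <= Num.max m x by rewrite le_max m0.
rewrite [EmaxN _ _ _]/=.
have key (b c : R) : 0 <= b -> 0 <= c -> (forall x, b + c * \1_A x <=
    if v <= Num.max m x then v else v * (1 - (1 - p) ^+ h)) ->
    ((b + c * p)%:E <= \int[D]_x EmaxN D h (Num.max m x))%E.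
  move=> b0 c0 bc; rewrite EFinD EFinM -DAp -[b%:E]mule1 -(probability_setT D).
  apply: integral_ge_indic => // x; apply: le_trans (IHh _ (M0 x)).
  by rewrite lee_fin.
have [vm|mv] := leP v m.
  have := key v 0; rewrite mul0r addr0; apply => // x.
  by rewrite mul0r addr0 le_max vm.
have /andP[e0 e1] := e01 h.
(* One draw reaches v with probability p; this raises the bound from v (1 - (1 - p)^h) to v. *)
have -> : v * (1 - (1 - p) ^+ h.+1)
    = v * (1 - (1 - p) ^+ h) + v * (1 - p) ^+ h * p.
  by rewrite exprS; ring.
apply: key; [by rewrite mulr_ge0// subr_ge0|by rewrite mulr_ge0|move=> x].
rewrite indicE le_max [v <= m]leNgt mv/=.
have [vx|xv] := leP v x.
  by rewrite mem_set// mulr1 -mulrDr subrK mulr1.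
by rewrite memNset ?mulr0 ?addr0// /A/= leNgt xv.
Qed.

End MaxLowerBound.

(** * Finitely supported laws: integrals and series as finite sums *)

Section Atoms.
Context {R : realType}.

(** The law is the sum of Dirac masses w_k at x_k. The integral formula over a set [E] yields both
    its probabilities (f = 1) and its truncated means. *)
Lemma atomic_probability (N : nat) (w x : nat -> R) :
  (forall k, 0 <= w k) -> \sum_(k < N) w k = 1 ->
  exists D : probability R R, forall E (f : R -> R),
    measurable E -> measurable_fun E f ->
    (\int[D]_(y in E) (f y)%:E = (\sum_(k < N) w k * (\1_E (x k) * f (x k)))%:E)%E.
Proof.
move=> w0 w1.
pose mu : {measure set R -> \bar R} :=
  msum (fun k => mscale (NngNum (w0 k)) (dirac (x k))) N.
have muT : mu setT = 1%E.
  rewrite /mu /= /msum/= /mscale/=.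
  by under eq_bigr do rewrite diracT mule1; rewrite sumEFin w1.
pose isP := Measure_isProbability.Build _ _ _ (Measure.sort mu) muT.
pose D := HB.pack_for (probability R R) (Measure.sort mu) isP.
have intD E (f : R -> R) : measurable E -> measurable_fun E f ->
    (forall y, 0 <= f y) -> (\int[D]_(y in E) (f y)%:E
      = (\sum_(k < N) w k * (\1_E (x k) * f (x k)))%:E)%E.
  move=> mE mf f0; rewrite -sumEFin.
  have mEf : measurable_fun E (EFin \o f) by exact/measurable_EFinP.
  rewrite [LHS](_ : _ = \int[mu]_(y in E) (f y)%:E)%E// /mu.
  rewrite ge0_integral_measure_sum//; last by move=> y _; rewrite lee_fin.
  apply: eq_bigr => k _.
  rewrite ge0_integral_mscale//; last by move=> y _; rewrite lee_fin.
  by rewrite integral_dirac//= diracE EFinM EFinM.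
(* A signed f is split into its positive and negative parts, to which [intD] applies. *)
exists D => E f mE mf; rewrite integralE.
rewrite -[fun y => (f y)%:E]/(EFin \o f) funerpos funerneg !intD//; last 2 first.
- exact: measurable_funrneg.
- exact: measurable_funrpos.
rewrite -EFinB -sumrB; congr EFin; apply: eq_bigr => k _.
by rewrite -mulrBr -mulrBr -[in RHS](funrposBneg f).
Qed.

Lemma indic_pred (P : pred R) (y : R) : \1_[set z | P z] y = (P y)%:R :> R.
Proof.
by rewrite indicE; congr (nat_of_bool _)%:R; apply/idP/idP => [/set_mem|/mem_set].
Qed.

(** Mass function of a horizon with masses a_k at n_k; coinciding atoms add up. *)
Definition atoms (N : nat) (a : nat -> R) (n : nat -> nat) (h : nat) : R :=
  \sum_(k < N) a k * (h == n k)%:R.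

Lemma atoms_ge0 N a n h : (forall k, 0 <= a k) -> 0 <= atoms N a n h.
Proof. by move=> a0; apply: sumr_ge0 => k _; rewrite mulr_ge0. Qed.

Lemma nneseries_atoms N a n (F : nat -> \bar R) :
  (forall k, 0 <= a k) -> (forall h, (0 <= F h)%E) ->
  (\sum_(h <oo) (atoms N a n h)%:E * F h = \sum_(k < N) (a k)%:E * F (n k))%E.
Proof.
move=> a0 F0.
have ab k h : (0 <= (a k * (h == n k)%:R)%:E)%E by rewrite lee_fin mulr_ge0.
transitivity (\sum_(h <oo) \sum_(k < N) (a k * (h == n k)%:R)%:E * F h)%E.
  by apply: eq_eseriesr => h _; rewrite /atoms -sumEFin ge0_sume_distrl.
rewrite nneseries_sum; last by move=> k h _; rewrite mule_ge0.
apply: eq_bigr => k _; rewrite (@nneseriesD1 _ _ (n k))//; last first.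
  by move=> h _; rewrite mule_ge0.
rewrite eqxx mulr1 eseries0 ?adde0// => h _ /= /negbTE ->.
by rewrite mulr0 mul0e.
Qed.

Lemma nneseries_atoms_fin N a n (F : nat -> R) :
  (forall k, 0 <= a k) -> (forall h, 0 <= F h) ->
  (\sum_(h <oo) (atoms N a n h * F h)%:E = (\sum_(k < N) a k * F (n k))%:E)%E.
Proof.
move=> a0 F0; rewrite -sumEFin.
under eq_eseriesr do rewrite EFinM.
by rewrite (nneseries_atoms _ _ _ (fun h => (F h)%:E)).
Qed.

Lemma tailH_atoms N a n i : (forall k, 0 <= a k) ->
  tailH (atoms N a n) i = (\sum_(k < N) a k * (i <= n k)%N%:R)%:E.
Proof.
move=> a0; rewrite -(nneseries_atoms_fin N a n (fun h => (i <= h)%N%:R))//.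
rewrite /tailH eseries_cond eseries_mkcond; apply: eq_eseriesr => h _ /=.
by case: leqP; rewrite ?mulr1 ?mulr0.
Qed.

End Atoms.

(** * Membership of finitely supported horizons in G-bar *)

Section GbarAtoms.
Context {R : realType}.

(** The bound is the closed form (t / mu) / (1 - r) of the geometric series of ratio r = (1 - 1/mu)
    t; each partial sum lies below it. *)
Lemma pgf_geom_le (mu t : R) : 1 <= mu -> 0 < t < 1 ->
  (pgf_geom mu t <= (t / (1 + (mu - 1) * (1 - t)))%:E)%E.
Proof.
move=> mu1 /andP[t0 t1].
have mu0 : 0 < mu by lra.
have mui0 : 0 <= mu^-1 by rewrite invr_ge0 ltW.
have mui1 : mu^-1 <= 1 by rewrite invf_le1.
set r := (1 - mu^-1) * t.
have r0 : 0 <= r by rewrite mulr_ge0 ?subr_ge0// ltW.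
have r1 : r < 1 by rewrite /r; nra.
have term0 h : 0 <= mu^-1 * (1 - mu^-1) ^+ h.-1 * t ^+ h.
  by rewrite !mulr_ge0// exprn_ge0 ?subr_ge0// ltW.
apply: lime_le; first by apply: is_cvg_nneseries => h _ _; rewrite lee_fin.
apply: nearW => N; rewrite sumEFin lee_fin big_add1 big_mkord /=.
under eq_bigr => i _ do rewrite exprS mulrACA -exprMn -/r.
rewrite -mulr_sumr.
have := sum_expr_le _ N.-1 (introT andP (conj r0 r1)).
move=> /(ler_wpM2l (mulr_ge0 mui0 (ltW t0))) /le_trans; apply.
have -> : 1 + (mu - 1) * (1 - t) = mu * (1 - r) by rewrite /r; field; lra.
by rewrite invfM mulrA [t / mu]mulrC.
Qed.

Context (m : nat) (a : nat -> R) (n : nat -> nat)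
  (a_ge0 : forall k, 0 <= a k) (a_sum : \sum_(k < m.+1) a k = 1).

Lemma horizon_atoms : (forall k, 0 < n k)%N -> horizon (atoms m.+1 a n).
Proof.
move=> n0; split.
- by move=> h; exact: atoms_ge0.
- by rewrite /atoms big1// => k _; rewrite eq_sym gtn_eqF// mulr0.
- under eq_eseriesr do rewrite -[atoms _ _ _ _]mulr1.
  rewrite (nneseries_atoms_fin _ _ _ (fun=> 1))//.
  by congr EFin; rewrite -[RHS]a_sum; apply: eq_bigr => k _; rewrite mulr1.
- under eq_eseriesr do rewrite mulrC.
  by rewrite (nneseries_atoms_fin _ _ _ (fun h => h%:R))// ltry.
Qed.

Lemma meanH_atoms : meanH (atoms m.+1 a n) = \sum_(k < m.+1) a k * (n k)%:R.
Proof.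
rewrite /meanH; under eq_eseriesr do rewrite mulrC.
by rewrite (nneseries_atoms_fin _ _ _ (fun h => h%:R)).
Qed.

(** Factor t out of E t^H and average the tangent-line bound over the atoms with N = H - 1 > 0. The
    condition on [n k.+1] ensures N >= 2 there. *)
Lemma Gbar_atoms : n 0%N = 1%N -> (forall k, 2 < n k.+1)%N ->
  \sum_(i < m) a i.+1 <= 4^-1 -> Gbar (atoms m.+1 a n).
Proof.
move=> n01 n2 a4; have n_gt0 k : (0 < n k)%N.
  by case: k => [|k]; [rewrite n01|exact: leq_trans (n2 k)].
split; first exact: horizon_atoms.
move=> t /andP[t0 t1]; rewrite meanH_atoms.
pose n' i := (n i.+1).-1.
have nE i : n i.+1 = (n' i).+1 by rewrite prednK.
set M := \sum_(i < m) a i.+1 * (n' i)%:R.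
have M0 : 0 <= M by apply: sumr_ge0 => i _; rewrite mulr_ge0.
have muE : \sum_(k < m.+1) a k * (n k)%:R = 1 + M.
  rewrite -[X in X + M]a_sum !big_ord_recl /M n01 mulr1n mulr1 -addrA -big_split/=; congr +%R.
  by apply: eq_bigr => i _; rewrite /bump/= add1n nE -natr1 mulrDr mulr1 addrC.
rewrite muE; apply: le_trans (pgf_geom_le _ _ _ _) _; [lra|lra|].
rewrite /pgfH (nneseries_atoms_fin _ _ _ (fun h => t ^+ h))//; last first.
  by move=> h; rewrite exprn_ge0// ltW.
rewrite lee_fin addrAC subrr add0r; set s := 1 - t; set z := M * s.
have s01 : 0 <= s <= 1 by rewrite /s; lra.
have z0 : 0 <= z by rewrite mulr_ge0//; case/andP: s01.
have ts : t = 1 - s by rewrite /s; lra.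
have z1 : 0 < 1 + z by lra.
set P := (1 + z) ^+ 2; have P0 : 0 < P by rewrite exprn_gt0.
have bound i : a i.+1 - (a i.+1 * (n' i)%:R * s + a i.+1 * (4 * z ^+ 2)) / P
    <= a i.+1 * t ^+ n' i.
  have h : 1 - ((n' i)%:R * s + 4 * z ^+ 2) / P <= t ^+ n' i.
    by rewrite ts; apply: expr_1sub_ge => //; rewrite -ltnS -nE.
  by move: (ler_wpM2l (a_ge0 i.+1) h); rewrite mulrBr mulr1 !mulrA mulrDr !mulrA.
have -> : \sum_(k < m.+1) a k * t ^+ n k
    = t * (a 0%N + \sum_(i < m) a i.+1 * t ^+ n' i).
  rewrite big_ord_recl n01 expr1 mulrDr [t * a _]mulrC mulr_sumr; congr +%R.
  by apply: eq_bigr => i _; rewrite lift0 nE exprS mulrCA.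
rewrite ler_pM2l//.
have : a 0%N + \sum_(i < m) (a i.+1 -
       (a i.+1 * (n' i)%:R * s + a i.+1 * (4 * z ^+ 2)) / P)
    <= a 0%N + \sum_(i < m) a i.+1 * t ^+ n' i.
  by rewrite lerD2l; apply: ler_sum.
apply: le_trans.
rewrite sumrB addrA -mulr_suml big_split/= -!mulr_suml -/M -/z.
have -> : a 0%N + \sum_(i < m) a i.+1 = 1 by rewrite -a_sum big_ord_recl.
(* The mass 1/4 compensates the factor 4 of the tangent line, so the total loss is at most (z + z^2)
   / (1 + z)^2 = 1 - 1 / (1 + z). *)
have : (\sum_(i < m) a i.+1) * (4 * z ^+ 2) <= z ^+ 2.
  rewrite -[leRHS]mul1r mulrA ler_wpM2r ?exprn_ge0//; lra.
rewrite -(lerD2l z) => h.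
have -> : (1 + z)^-1 = 1 - (z + z ^+ 2) / P.
  by rewrite /P; move: (z) z1 => y y1; field; rewrite gt_eqF.
by rewrite lerB// ler_pM2r ?invr_gt0.
Qed.

End GbarAtoms.

(** * The multi-scale instance and its prophet and threshold values *)

Section HardInstance.
Context {R : realType}.

(* The weights [b 1, ..., b m], with the missing mass put on [0]. *)
Definition complete_at0 (b : nat -> R) (m k : nat) : R :=
  if k == 0%N then 1 - \sum_(i < m) b i.+1 else b k.

Lemma sum_complete_at0 (b : nat -> R) m :
  \sum_(k < m.+1) complete_at0 b m k = 1.
Proof.
by rewrite big_ord_recl; exact: subrK.
Qed.

Lemma complete_at0_ge0 (b : nat -> R) m k : (forall i, 0 <= b i) ->
  \sum_(i < m) b i.+1 <= 1 -> 0 <= complete_at0 b m k.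
Proof. by move=> b0 b1; rewrite /complete_at0; case: eqP => _; rewrite ?subr_ge0. Qed.

Lemma complete_at0_le (b : nat -> R) m k : (forall i, 0 <= b i) ->
  complete_at0 b m k <= if k == 0%N then 1 else b k.
Proof.
move=> b0; rewrite /complete_at0; case: eqP => // _.
by rewrite gerBl; apply: sumr_ge0.
Qed.

(** The factor 1/4 keeps the mass of the scales k >= 1 below 1/4, as membership in G-bar
    requires. *)
Definition aH := complete_at0 (fun k => 2^-1 ^+ k / 4).
Definition wX := complete_at0 (fun k => 4^-1 ^+ k).

Lemma sum_aH_tail m : \sum_(i < m) (2^-1 ^+ i.+1 / 4 : R) <= 4^-1.
Proof.
by rewrite -mulr_suml; have := @sum_exprS_le R 2^-1 m ltac:(lra); lra.
Qed.

Lemma aH_ge0 m k : 0 <= aH m k.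
Proof.
apply: complete_at0_ge0 => [i|]; first by rewrite divr_ge0// exprn_ge0// invr_ge0.
by have := sum_aH_tail m; lra.
Qed.

Lemma aH_le m k : aH m k <= 2^-1 ^+ k.
Proof.
have e0 i : 0 <= 2^-1 ^+ i :> R by rewrite exprn_ge0// invr_ge0.
apply: le_trans (complete_at0_le _ _ _ _) _.
  by move=> i; rewrite divr_ge0.
by case: k => [|k] /=; [rewrite expr0|have := e0 k.+1; lra].
Qed.

Lemma wX_ge0 m k : 0 <= wX m k.
Proof.
apply: complete_at0_ge0 => [i|]; first by rewrite exprn_ge0// invr_ge0.
by have := @sum_exprS_le R 4^-1 m ltac:(lra); lra.
Qed.

Lemma wX_le m k : wX m k <= 4^-1 ^+ k.
Proof.
apply: le_trans (complete_at0_le _ _ _ _) _.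
  by move=> i; rewrite exprn_ge0// invr_ge0.
by case: k => [|k] //=; rewrite expr0.
Qed.

Lemma sum_wX m : \sum_(k < m.+1) wX m k = 1.
Proof. exact: sum_complete_at0. Qed.

Definition qH m : nat -> R := atoms m.+1 (aH m) (expn 4).

Lemma Gbar_qH m : Gbar (qH m).
Proof.
apply: Gbar_atoms => //.
- exact: aH_ge0.
- exact: sum_complete_at0.
- by move=> k; rewrite expnS (@leq_trans (4 * 1))// leq_pmul2l// expn_gt0.
- exact: sum_aH_tail.
Qed.

Context (m : nat) (D : probability R R)
  (D_atoms : forall E (f : R -> R), measurable E -> measurable_fun E f ->
    (\int[D]_(y in E) (f y)%:E
     = (\sum_(k < m.+1) wX m k * (\1_E (2 ^+ k) * f (2 ^+ k)))%:E)%E).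

Lemma law_atoms E : measurable E ->
  D E = (\sum_(k < m.+1) wX m k * \1_E (2 ^+ k))%:E.
Proof.
move=> mE; rewrite -[LHS]mul1e -integral_cst//.
rewrite (D_atoms E (fun=> 1))//; congr EFin.
by apply: eq_bigr => k _; rewrite mulr1.
Qed.

Lemma nonneg_integrable_law : nonneg_integrable D.
Proof.
have mlt : measurable [set x : R | x < 0] by rewrite -set_itvNyo; exact: measurable_itv.
split.
  rewrite law_atoms// big1// => k _; rewrite indicE memNset ?mulr0//.
  by apply/negP; rewrite -leNgt exprn_ge0.
apply/integrableP; split; first exact/measurable_EFinP.
by rewrite (D_atoms setT (fun x => `|x|))// ltry.
Qed.

(** For k >= 1 the atom at 2^k alone gives P(X >= 2^k) >= 4^-k, so 4^k draws reach 2^k with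
    probability at least 1/2. The scale contributes at least (2^-k / 4) 2^k / 2 = 1/8. *)
Lemma prophet_ge : ((m%:R / 8)%:E <= prophet D (qH m))%E.
Proof.
have mge v : measurable [set x : R | v <= x].
  by rewrite -set_itvcy; exact: measurable_itv.
rewrite /prophet (nneseries_atoms _ _ _ (Defs.EM D)).
- rewrite big_ord_recl /= -[leLHS]add0e; apply: leeD.
    rewrite mule_ge0 ?lee_fin ?aH_ge0//.
    by have := EmaxN_ge D 0 (4 ^ 0) 0 (lexx _) (lexx _); rewrite lexx.
  have -> : m%:R / 8 = \sum_(i < m) 8^-1 :> R.
    by rewrite sumr_const card_ord mulr_natl.
  rewrite -sumEFin; apply: lee_sum => i _.
  rewrite /bump /= add1n; set k := i.+1.
  have v0 : 0 < 2 ^+ k :> R by rewrite exprn_gt0.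
  have := EmaxN_ge D (2 ^+ k) (4 ^ k) 0 (ltW v0) (lexx _).
  rewrite (lt_geF v0); set p := fine _.
  have p_ge : (4 ^ k)%N%:R^-1 <= p.
    rewrite /p law_atoms//= (bigD1 (lift ord0 i))//= indicE.
    rewrite mem_set ?mulr1 /=; last by rewrite /bump/= add1n.
    rewrite natrX -exprVn ler_wpDr//.
    by apply: sumr_ge0 => j _; rewrite mulr_ge0 ?wX_ge0// indicE.
  have p1 : p <= 1 by rewrite -lee_fin fineK ?fin_num_measure// probability_le1.
  have : (1 - p) ^+ (4 ^ k) <= 2^-1.
    apply: le_trans (expr_1subV_le (4 ^ k) _); last by rewrite expn_gt0.
    by rewrite lerXn2r ?nnegrE; lra.
  move=> h EM_ge; have ak : 0 <= aH m k by exact: aH_ge0.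
  have ak' : (0 <= (aH m k)%:E)%E by rewrite lee_fin.
  apply: le_trans (lee_wpmul2l ak' EM_ge); rewrite -EFinM lee_fin.
  have -> : aH m k = 2^-1 ^+ k / 4 by [].
  have : 2^-1 ^+ k * 2 ^+ k = 1 :> R by rewrite -exprMn mulVf ?expr1n.
  set e := (1 - p) ^+ _ in h *; set y := 2^-1 ^+ k; set x := 2 ^+ k => yx.
  have -> : y / 4 * (x * (1 - e)) = (y * x) * (1 - e) / 4 by ring.
  by rewrite yx; lra.
- exact: aH_ge0.
- move=> h; have := EmaxN_ge D 0 h 0 (lexx _) (lexx _).
  by rewrite lexx.
Qed.

(* A rule stopping at each step with probability [1 - r >= 4^-j] is stopped
   within [4^j] steps on average, so [H = 4^k] counts for at most
   [min(4^k, 4^j)] steps. *)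
Lemma stopping_weight_le (r : R) N j : 0 <= r -> 4^-1 ^+ j <= 1 - r ->
  \sum_(i < N) \sum_(k < m.+1) aH m k * (i < 4 ^ k)%N%:R * r ^+ i
    <= 3 * 2 ^+ j.
Proof.
move=> r0 rj.
have j0 : 0 < 4^-1 ^+ j :> R by rewrite exprn_gt0// invr_gt0.
have four i : 2^-1 ^+ i * 4 ^+ i = 2 ^+ i :> R.
  by rewrite -exprMn; congr (_ ^+ i); lra.
have le1 k : \sum_(i < N) (i < 4 ^ k)%N%:R * r ^+ i <= 4 ^+ k.
  by rewrite -natrX; apply: sum_ltn_expr_le; rewrite r0/=; lra.
have le2 k : \sum_(i < N) (i < 4 ^ k)%N%:R * r ^+ i <= 4 ^+ j.
  apply: le_trans (_ : \sum_(i < N) r ^+ i <= _).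
    by apply: ler_sum => i _; rewrite ler_piMl ?exprn_ge0//; case: leqP.
  apply: le_trans (sum_expr_le _ _ _) _; first by rewrite r0; lra.
  by rewrite -[leRHS]invrK -exprVn lef_pV2// posrE; lra.
rewrite exchange_big /=.
(* Since [aH m k] is at most 2^-k, a scale k < j costs at most 2^-k 4^k = 2^k and a scale k >= j at
   most 2^-k 4^j. These sum to at most 2^j and 2 * 2^j. *)
apply: le_trans (_ : \sum_(k < m.+1) ((k < j)%N%:R * 2 ^+ k +
    (j <= k)%N%:R * 2^-1 ^+ k * 4 ^+ j) <= _); last first.
  rewrite big_split/= -mulr_suml.
  have := @sum_ltn_exp2_le R m.+1 j.
  have : (\sum_(k < m.+1) (j <= k)%N%:R * 2^-1 ^+ k) * 4 ^+ j <= 2 * 2 ^+ j :> R.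
    rewrite -four mulrA ler_wpM2r ?exprn_ge0//; exact: sum_geq_half_le.
  by lra.
apply: ler_sum => k _.
under eq_bigr do rewrite -mulrA.
rewrite -mulr_sumr; have [kj|jk] := ltnP k j.
  rewrite mul1r !mul0r addr0 -four ler_pM ?aH_ge0 ?aH_le//.
  by apply: sumr_ge0 => i _; rewrite mulr_ge0 ?exprn_ge0.
rewrite mul1r !mul0r add0r ler_pM ?aH_ge0 ?aH_le//.
by apply: sumr_ge0 => i _; rewrite mulr_ge0 ?exprn_ge0.
Qed.

(** The value factors as the expected number of inspected steps times s = E[X; X >= pi]. If 2^j is
    the least atom reaching pi, these are at most 3 * 2^j and 2 * 2^-j. *)
Lemma threshold_value_le (pi : R) : (threshold_value D (qH m) pi <= 6%:E)%E.
Proof.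
have mge : measurable [set x : R | pi <= x].
  by rewrite -set_itvcy; exact: measurable_itv.
have mlt : measurable [set x : R | x < pi].
  by rewrite -set_itvNyo; exact: measurable_itv.
set s := \sum_(k < m.+1) wX m k * ((pi <= 2 ^+ k)%R%:R * 2 ^+ k).
have sE : (\int[D]_(x in [set x | (pi <= x)%R]) x%:E = s%:E)%E.
  rewrite (D_atoms _ id)//; congr EFin; apply: eq_bigr => k _.
  by rewrite (indic_pred (fun x => pi <= x)).
set r := fine (D [set x | x < pi]).
have rE : r = \sum_(k < m.+1) wX m k * (2 ^+ k < pi)%R%:R.
  rewrite /r law_atoms//; apply: eq_bigr => k _.
  by rewrite (indic_pred (fun x => x < pi)).
have r0 : 0 <= r by rewrite rE; apply: sumr_ge0 => k _; rewrite mulr_ge0 ?wX_ge0.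
have s0 : 0 <= s.
  by apply: sumr_ge0 => k _; rewrite !mulr_ge0 ?wX_ge0 ?exprn_ge0.
pose T i := \sum_(k < m.+1) aH m k * (i <= 4 ^ k)%N%:R * r ^+ i.-1.
have T0 i : 0 <= T i.
  by apply: sumr_ge0 => k _; rewrite !mulr_ge0 ?aH_ge0 ?exprn_ge0.
have termE i : (tailH (qH m) i * (r ^+ i.-1)%:E * s%:E = (T i * s)%:E)%E.
  rewrite /T -mulr_suml.
  by rewrite tailH_atoms -?EFinM// => k; exact: aH_ge0.
rewrite /threshold_value sE -/r; under eq_eseriesr do rewrite termE.
apply: lime_le; first by apply: is_cvg_nneseries => i _ _; rewrite lee_fin mulr_ge0.
apply: nearW => N; rewrite sumEFin lee_fin -mulr_suml big_add1 big_mkord /=.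
(* A threshold above all atoms never stops and earns 0. *)
have [above|] := boolP [forall k : 'I_m.+1, 2 ^+ k < pi].
  have -> : s = 0; last by rewrite mulr0.
  apply: big1 => k _; move/forallP: above => /(_ k); rewrite ltNge => /negbTE ->.
  by rewrite mul0r mulr0.
rewrite negb_forall => /existsP[k0]; rewrite -leNgt => k0P.
have ex : exists k, (pi <= 2 ^+ k) && (k < m.+1)%N by exists k0; rewrite k0P /=.
case: (ex_minnP ex) => j /andP[pij jm] jmin.
have below k : (k < j)%N -> (k < m.+1)%N -> (pi <= 2 ^+ k) = false.
  move=> kj km; apply/negP => pik; have := jmin k; rewrite pik km => /(_ isT).
  by rewrite leqNgt kj.
have sj : s <= 2 * 2^-1 ^+ j.
  apply: le_trans (@sum_geq_half_le R m.+1 j); apply: ler_sum => k _.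
  have [kj|jk] := ltnP k j; first by rewrite below// !mul0r mulr0.
  rewrite mul1r; apply: le_trans (_ : 4^-1 ^+ k * 2 ^+ k <= _); last first.
    by rewrite -exprMn; apply: lerXn2r; rewrite ?nnegrE; lra.
  rewrite ler_pM ?wX_ge0 ?wX_le ?mulr_ge0 ?exprn_ge0//.
  by rewrite ler_piMl ?exprn_ge0// lern1 leq_b1.
have rj : 4^-1 ^+ j <= 1 - r.
  have -> : 1 - r = \sum_(k < m.+1) wX m k * (pi <= 2 ^+ k)%R%:R.
    rewrite -[X in X - _](sum_wX m) rE -sumrB.
    by apply: eq_bigr => k _; rewrite ltNge;
      case: (_ <= _); rewrite ?mulr1 ?mulr0 ?subrr ?subr0.
  (* At j = 0 every atom reaches pi and the total mass 1 is used, since [wX m 0] is the completed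
     mass and may be less than 1. For j > 0 the atom at 2^j suffices. *)
  case: j pij jm jmin below sj => [|j] pij jm jmin below sj.
    rewrite expr0 -[leLHS](sum_wX m); apply: ler_sum => k _.
    by rewrite (le_trans pij) ?mulr1// expr0 exprn_ege1// ler1n.
  rewrite (bigD1 (Ordinal jm))//= pij mulr1 ler_wpDr//.
  by apply: sumr_ge0 => k _; rewrite mulr_ge0 ?wX_ge0.
have := stopping_weight_le _ N.-1 _ r0 rj; rewrite -/(T _) => hT.
have -> : 6 = 3 * 2 ^+ j * (2 * 2^-1 ^+ j) :> R.
  by rewrite exprVn; field; rewrite expf_neq0.
by rewrite ler_pM// sumr_ge0.
Qed.

End HardInstance.

(* No constant c > 0 makes single thresholds c-competitive on G-bar:
   for every c > 0 there are H in G-bar and D such that every threshold pi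
   has E X_{tau_pi} < c E M_H. *)
Theorem theorem3 (R : realType) :
  ~ (exists c : R, 0 < c /\
       forall q : nat -> R, Gbar q ->
       forall D : probability R R, nonneg_integrable D ->
       exists pi : R,
         (threshold_value D q pi >= c%:E * prophet D q)%E).
Proof.
move=> [c [c0 approx]].
(* This makes c m / 8 > 6. *)
have [m m_gt] : exists m : nat, 48 / c < m%:R.
  by exists (Num.bound (48 / c)); rewrite archi_boundP// divr_ge0// ltW.
have [D D_atoms] := @atomic_probability R m.+1 (wX m) (fun k => 2 ^+ k)
  (wX_ge0 m) (sum_wX m).
have [pi] := approx _ (Gbar_qH m) D (nonneg_integrable_law m D D_atoms).
move=> /le_trans/(_ (threshold_value_le m D D_atoms pi)); apply/negP.
rewrite -ltNge; have : (6%:E < c%:E * (m%:R / 8)%:E)%E.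
  by rewrite -EFinM lte_fin; move: m_gt; rewrite ltr_pdivrMr//; lra.
move=> /lt_le_trans; apply.
by apply: lee_wpmul2l; [rewrite lee_fin ltW|exact: prophet_ge].
Qed.
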